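(* Let $G$ be a finite, simple, undirected graph. If $G$ is connected and claw-free, then $Z_+(G) = Z(G)$, where $Z(G)$ is the standard (zero) forcing number of $G$ and $Z_+(G)$ is the positive semidefinite (zero) forcing number of $G$.
   Context: All graphs are finite, simple and undirected. A graph is claw-free if it has no induced subgraph isomorphic to $K_{1,3}$. Forcing process: the vertex set is partitioned as $V(G) = B \cup W$ into blue vertices $B$ and white vertices $W$. A color change rule specifies when a blue vertex $u \in B$ may force a white vertex $v \in W$ to become blue. At each time step some set of valid forces (with respect to the current coloring) is performed, no white vertex being forced by more than one vertex, and the forced vertices are moved from $W$ to $B$. This is repeated until no further color changes are possible. If all vertices of $G$ are then blue, the initial set $B$ is called a forcing set of $G$ under the given rule. Standard forcing rule: a blue vertex $u$ may force a white vertex $v$ if $v$ is the only white neighbor of $u$ in $G$. $Z(G)$ is the minimum cardinality of a forcing set under this rule (a standard forcing set). Positive semidefinite forcing rule: a blue vertex $u$ may force a white vertex $v$ if $v$ is the only neighbor of $u$ in the connected component of the induced subgraph $G[W]$ that contains $v$, where $W$ is the current set of white vertices. $Z_+(G)$ is the minimum cardinality of a forcing set under this rule (a positive semidefinite forcing set). *)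

(* Defs.v *)
From mathcomp Require Import all_boot.

Set Implicit Arguments.
Unset Strict Implicit.
Unset Printing Implicit Defensive.

Record sgraph := SGraph {
  vertex :> finType;
  adj : rel vertex;
  adj_sym : symmetric adj;
  adj_irrefl : irreflexive adj
}.

(* The graph without vertices counts as connected. *)
Definition connected_graph (G : sgraph) : Prop :=
  forall x y : G, connect (@adj G) x y.

(* G has an induced subgraph isomorphic to H. *)
Definition has_induced (H G : sgraph) : Prop :=
  exists f : H -> G, injective f /\ forall x y : H, adj (f x) (f y) = adj x y.

Section CompleteBipartite.
Variables m n : nat.

Definition Kmn_adj (x y : 'I_m + 'I_n) : bool :=
  match x, y with
  | inl _, inr _ | inr _, inl _ => true
  | _, _ => false
  end.

Lemma Kmn_sym : symmetric Kmn_adj.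
Proof. by case=> i [] j. Qed.

Lemma Kmn_irrefl : irreflexive Kmn_adj.
Proof. by case. Qed.

Definition Kmn : sgraph := SGraph Kmn_sym Kmn_irrefl.

End CompleteBipartite.

Definition claw_free (G : sgraph) : Prop := ~ has_induced (Kmn 1 3) G.

Section Forcing.
Variable G : sgraph.
Implicit Types (B W : {set G}) (u v : G).

(* A color change rule: [rule B u v] tells whether the vertex u may force the
   vertex v when the set of blue vertices is B.  That u is blue and v is white
   is imposed separately, in [valid_force]. *)
Definition color_rule := {set G} -> rel G.

Definition valid_force (rule : color_rule) B u v : bool :=
  [&& u \in B, v \notin B & rule B u v].

(* One time step: a set F of valid forces, a force of v by u being the pair
   (u, v), is performed simultaneously; distinct forces in F have distinct
   targets. *)
Definition forcing_step (rule : color_rule) : rel {set G} := fun B B' =>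
  [exists F : {set G * G},
    [&& [forall f in F, valid_force rule B f.1 f.2],
        dinjectiveb snd (mem F)
      & B' == B :|: [set f.2 | f in F]]].

(* Once every vertex is blue no force is valid, so reaching [set: G] means that
   the process has stopped there.  For the two rules below a force on a white
   vertex stays valid as other vertices turn blue, so the final blue set does
   not depend on the forces performed along the way. *)
Definition forcing_set (rule : color_rule) B : bool :=
  connect (forcing_step rule) B [set: G].

(* [set: G] is a forcing set, so the minimum is taken over a nonempty family. *)
Definition forcing_number (rule : color_rule) : nat :=
  #|[arg min_(B < [set: G] | forcing_set rule B) #|B|]|.

(* The vertex set of the connected component of v in G[W], for v in W. *)
Definition component_in W v : {set G} :=
  [set w in W | connect [rel x y | [&& x \in W, y \in W & adj x y]] v w].

Definition standard_rule : color_rule := fun B u v =>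
  [set w in ~: B | adj u w] == [set v].

Definition psd_rule : color_rule := fun B u v =>
  [set w in component_in (~: B) v | adj u w] == [set v].

End Forcing.

Definition Z (G : sgraph) : nat := forcing_number (@standard_rule G).

Definition Zplus (G : sgraph) : nat := forcing_number (@psd_rule G).

(* Main.v *)
Require Import Defs.
From mathcomp Require Import all_boot.

(** In any connected graph, some minimum psd forcing set [B] leaves a connected
    white graph: choose [B] and a white component [C] with [C] as large as
    possible.  If [u] forces [v] then [B - u + v] is again psd forcing, since [v]
    can force [u] back.  If a blue neighbour [b] of [C] had a neighbour in another
    white component [D], one could shrink [D] by such exchanges until a neighbour
    of [C] forces into [D], and that exchange would enlarge [C].  If a blue
    neighbour [b] of [C] is adjacent to a blue vertex [b'] that is not a
    neighbour of [C], then [b] could force [b'], so [B] was not minimum.  Hence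
    [C] and its neighbours exhaust the connected graph.

    In a claw-free graph a force of [v] by [u] never disconnects a connected
    white set: [v] would form a claw with [u] and two neighbours in different
    pieces.  So from such a [B] every psd force is a standard force. *)

Set Implicit Arguments.
Unset Strict Implicit.
Unset Printing Implicit Defensive.

Lemma claw_freeP (G : sgraph) (c a1 a2 a3 : G) :
  claw_free G -> adj c a1 -> adj c a2 -> adj c a3 ->
  a1 != a2 -> a1 != a3 -> a2 != a3 -> [|| adj a1 a2, adj a1 a3 | adj a2 a3].
Proof.
move=> clawG c1 c2 c3 n12 n13 n23; apply/negPn/negP.
rewrite !negb_or => /and3P[/negbTE a12 /negbTE a13 /negbTE a23].
apply: clawG; pose l := [:: a1; a2; a3].
exists (fun x : Kmn 1 3 => match x with inl _ => c | inr i => nth c l i end).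
have cl i : i < 3 -> adj c (nth c l i) by case: i => [|[|[|]]].
have nl i : i < 3 -> c != nth c l i.
  by move/cl; apply: contraTneq => <-; rewrite adj_irrefl.
have ul : uniq l by rewrite /= !inE negb_or n12 n13 n23.
split.
- case=> [i|i] [j|j].
  + by rewrite !ord1.
  + by move/eqP; rewrite (negbTE (nl _ (ltn_ord j))).
  + by move/esym/eqP; rewrite (negbTE (nl _ (ltn_ord i))).
  + by move/eqP; rewrite nth_uniq // => /eqP/ord_inj->.
- case=> [i|i] [j|j] /=.
  + exact: adj_irrefl.
  + exact: cl.
  + by rewrite adj_sym cl.
  + by case: i => [[|[|[|i]]] i3] //; case: j => [[|[|[|j]]] j3] //=;
       rewrite ?adj_irrefl // ?a12 ?a13 ?a23 // adj_sym ?a12 ?a13 ?a23.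
Qed.

Section ForcingSets.
Variable G : sgraph.
Implicit Types (B W X S : {set G}) (u v w x y z : G) (rule : color_rule G).

Lemma valid_force_step rule B u v :
  valid_force rule B u v -> forcing_step rule B (v |: B).
Proof.
move=> Buv; apply/existsP; exists [set (u, v)]; apply/and3P; split.
- by apply/forall_inP => f /set1P ->.
- by apply/dinjectiveP => f g /set1P -> /set1P ->.
- by rewrite imset_set1 setUC.
Qed.

Lemma forcing_set_force rule B u v :
  valid_force rule B u v -> forcing_set rule (v |: B) -> forcing_set rule B.
Proof. by move=> /valid_force_step/connect1; apply: connect_trans. Qed.

Lemma forcing_step_mono rule1 rule2 :
  (forall B u v, valid_force rule1 B u v -> valid_force rule2 B u v) ->
  subrel (forcing_step rule1) (forcing_step rule2).
Proof.
move=> r12 B B' /existsP[F /and3P[/forall_inP Fr Fi FB]].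
apply/existsP; exists F; rewrite Fi FB !andbT.
by apply/forall_inP => f /Fr /r12.
Qed.

Definition monotone_rule rule := forall B X u v,
  B \subset X -> v \notin X -> rule B u v -> rule X u v.

Lemma forcing_setP rule : monotone_rule rule -> forall B,
  forcing_set rule B <->
  (forall X, B \subset X -> X != setT -> exists u v, valid_force rule X u v).
Proof.
move=> mono B; split.
- move=> /connectP[p pth lst] X BX XT.
  elim: p B pth lst BX => [|B' p IHp] B /=.
    by move=> _ <-; rewrite subTset (negbTE XT).
  case/andP=> /existsP[F /and3P[/forall_inP Fv _ /eqP defB']] pth lst BX.
  have [B'X|] := boolP (B' \subset X); first exact: IHp pth lst B'X.
  rewrite defB' subUset BX => /subsetPn[_ /imsetP[f fF ->] f2X].
  have /and3P[f1B _ rf] := Fv f fF.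
  by exists f.1, f.2; rewrite /valid_force (subsetP BX) // f2X (mono B).
- have [n] := ubnP #|~: B|; elim: n B => // n IHn B /ltnSE leBn forceB.
  have [->|BT] := eqVneq B setT; first exact: connect0.
  have [u [v Buv]] := forceB B (subxx _) BT.
  apply: (forcing_set_force Buv); apply: IHn => [|X].
    apply: leq_trans leBn; apply: proper_card.
    rewrite properC properE subsetUr; apply/subsetPn; exists v; first exact: setU11.
    by case/and3P: Buv.
  by rewrite subUset => /andP[_]; apply: forceB.
Qed.

Lemma forcing_set_sup rule B X : monotone_rule rule ->
  B \subset X -> forcing_set rule B -> forcing_set rule X.
Proof.
move=> mono BX /(forcing_setP mono) forceB; apply/forcing_setP => // Y XY.
exact: forceB (subset_trans BX XY).
Qed.

Lemma forcing_number_min rule B : forcing_set rule B -> forcing_number rule <= #|B|.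
Proof.
rewrite /forcing_number; case: arg_minnP; first exact: connect0.
by move=> X _ minX /minX.
Qed.

Lemma forcing_number_ex rule : exists2 B, forcing_set rule B & #|B| = forcing_number rule.
Proof.
rewrite /forcing_number; case: arg_minnP; first exact: connect0.
by move=> X fX _; exists X.
Qed.

Lemma component_sub W v : component_in W v \subset W.
Proof. by apply/subsetP => w; rewrite inE => /andP[]. Qed.

Lemma component_id W v : v \in W -> v \in component_in W v.
Proof. by move=> vW; rewrite inE vW connect0. Qed.

Lemma component_adj W v x y :
  x \in component_in W v -> y \in W -> adj x y -> y \in component_in W v.
Proof.
rewrite !inE => /andP[xW vx] yW xy; rewrite yW (connect_trans vx) // connect1 //.
by rewrite /= xW yW.
Qed.

Lemma component_min W v S : v \in S ->
  (forall x y, x \in S -> x \in component_in W v -> y \in component_in W v ->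
    adj x y -> y \in S) ->
  component_in W v \subset S.
Proof.
move=> vS closS; apply/subsetP => w; rewrite inE => /andP[wW /connectP[p pth ->{w wW}]].
elim/last_ind: p pth => //= p w IHp; rewrite rcons_path last_rcons.
case/andP=> pth /and3P[lW wW lw].
have lC : last v p \in component_in W v by rewrite inE lW; apply/connectP; exists p.
exact: closS (IHp pth) lC (component_adj lC wW lw) lw.
Qed.

Lemma component_sym W x y : x \in W -> y \in component_in W x -> x \in component_in W y.
Proof.
move=> xW; rewrite !inE xW => /andP[yW]; rewrite (sym_connect_sym _) // => a b /=.
by rewrite adj_sym andbCA.
Qed.

Lemma component_trans W x y z :
  y \in component_in W x -> z \in component_in W y -> z \in component_in W x.
Proof. by rewrite !inE => /andP[_ xy] /andP[-> /(connect_trans xy)]. Qed.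

Lemma psd_forceP B u v :
  reflect [/\ u \in B, v \notin B, adj u v &
             forall w, w \in component_in (~: B) v -> adj u w -> w = v]
          (valid_force (@psd_rule G) B u v).
Proof.
apply: (iffP and3P) => [[uB vB /eqP/setP uv]|[uB vB uv uniq_v]]; split=> //.
- by have := uv v; rewrite !inE eqxx => /andP[].
- by move=> w wC uw; apply/set1P; rewrite -uv inE wC.
- apply/eqP/setP => w; rewrite in_set in_set1.
  apply/andP/eqP => [[]|->]; first exact: uniq_v.
  by split=> //; apply: component_id; rewrite inE.
Qed.

Lemma psd_rule_mono : monotone_rule (@psd_rule G).
Proof.
move=> B X u v BX vX /eqP/setP uv.
have vB : v \notin B by apply: contra vX => /(subsetP BX).
have CC : component_in (~: X) v \subset component_in (~: B) v.
  apply: component_min => [|x y xC _ yX]; first by rewrite component_id ?inE.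
  apply: component_adj xC _.
  by rewrite inE; apply: contra (subsetP BX y) _; rewrite -in_setC (subsetP (component_sub _ _) y yX).
apply/eqP/setP => w; rewrite in_set in_set1; apply/andP/eqP => [[wC uw]|->].
  by apply/set1P; rewrite -uv in_set (subsetP CC).
have := uv v; rewrite in_set in_set1 eqxx => /andP[_ ->].
by split=> //; apply: component_id; rewrite inE.
Qed.

Lemma standard_force_psd B u v :
  valid_force (@standard_rule G) B u v -> valid_force (@psd_rule G) B u v.
Proof.
case/and3P=> uB vB /eqP/setP uv; apply/psd_forceP; split=> //.
  by have := uv v; rewrite !inE eqxx => /andP[].
move=> w /(subsetP (component_sub _ _)) wB uw.
by apply/set1P; rewrite -uv inE wB.
Qed.

Lemma Zplus_le_Z : Zplus G <= Z G.
Proof.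
rewrite /Z; have [B stdB <-] := forcing_number_ex (@standard_rule G).
apply: forcing_number_min; apply: connect_sub stdB => X Y XY.
exact/connect1/(forcing_step_mono standard_force_psd).
Qed.

Notation psd_set := (forcing_set (@psd_rule G)).
Notation psd_force := (valid_force (@psd_rule G)).

Lemma psd_force_into B y : psd_set B -> y \notin B ->
  exists u v, psd_force B u v /\ v \in component_in (~: B) y.
Proof.
move=> psdB yB; set C := component_in (~: B) y.
have CB : C \subset ~: B by exact: component_sub.
have [||u [v /psd_forceP[uC vC uv uniq_v]]] :=
    proj1 (forcing_setP psd_rule_mono B) psdB (~: C).
- by rewrite -setCS setCK.
- apply/negP => /eqP/setP/(_ y).
  by rewrite !inE yB connect0.
rewrite in_setC negbK in vC; rewrite setCK in uniq_v.
exists u, v; split=> //; have vB := subsetP CB v vC.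
apply/psd_forceP; split=> //; last 1 first.
- move=> w wv; apply: uniq_v; apply: subsetP wv.
  apply: component_min => [|a b aC _ bv ab]; first exact: component_id.
  apply: (component_adj aC _ ab); apply: (component_adj _ _ ab).
    exact: (subsetP (component_sub _ _) _ aC).
  exact: (subsetP (component_sub _ _) _ bv).
- apply: contraLR uC => uB; rewrite in_setC negbK.
  by apply: (component_adj vC); rewrite ?in_setC // adj_sym.
- by rewrite in_setC in vB.
Qed.

Lemma psd_exchange B u v : psd_force B u v -> psd_set B ->
  psd_set (v |: B :\ u) /\ #|v |: B :\ u| = #|B|.
Proof.
case/psd_forceP=> uB vB uv uniq_v psdB.
have nuv : u != v by apply: contraNneq vB => <-.
split; last by rewrite cardsU1 !inE (negbTE vB) andbF (cardsD1 u B) uB.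
set B1 := v |: B :\ u; set C := component_in (~: B) v in uniq_v.
have vC : v \in C by rewrite component_id ?inE.
have B1C x : x \notin B1 -> x != u -> x \notin B.
  by rewrite !inE negb_or negb_and negbK => /andP[_ /orP[->|]].
have CB x : x \in C -> x \notin B.
  by move/(subsetP (component_sub _ _)); rewrite inE.
have uC : component_in (~: B1) u \subset ~: C.
  apply: component_min => [|x y xC xB1 yB1 xy].
    by rewrite inE; apply: contraL uB => /CB.
  rewrite !in_setC in xC *; apply: contra xC => yC.
  have yv : y != v.
    have := subsetP (component_sub _ _) y yB1.
    by rewrite !inE negb_or => /andP[].
  have [xu|xu] := eqVneq x u.
    by move: yv; rewrite (uniq_v y) ?eqxx // -xu.
  have := subsetP (component_sub _ _) x xB1; rewrite in_setC => /B1C/(_ xu) xB.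
  by apply: (component_adj yC); rewrite ?inE // adj_sym.
apply: (@forcing_set_force _ B1 v u).
  apply/psd_forceP; split; rewrite ?setU11 ?(adj_sym v) //.
    by rewrite !inE eqxx (negbTE nuv).
  move=> w wu vw; apply/eqP; apply/negPn/negP => nwu.
  have := subsetP uC w wu; rewrite in_setC => /negP; apply.
  have := subsetP (component_sub _ _) w wu; rewrite in_setC => /B1C/(_ nwu) wB.
  by apply: (component_adj vC); rewrite ?inE.
apply: forcing_set_sup psd_rule_mono _ psdB.
by apply/subsetP => x xB; rewrite !inE xB andbT; case: eqP; rewrite ?orbT.
Qed.

Definition maximal_white B x := [/\ psd_set B, #|B| = Zplus G, x \notin B &
  forall B' x', psd_set B' -> #|B'| = Zplus G -> x' \notin B' ->
    #|component_in (~: B') x'| <= #|component_in (~: B) x|].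

Section Maximal.
Variables (B : {set G}) (x : G).
Hypothesis maxBx : maximal_white B x.
Let C := component_in (~: B) x.

Lemma maximal_white_exchange u v : psd_force B u v -> v \notin C ->
  maximal_white (v |: B :\ u) x /\ component_in (~: (v |: B :\ u)) x = C.
Proof.
case: maxBx => psdB cardB xB max_x Buv vC.
have [psdB1 cardB1] := psd_exchange Buv psdB.
set B1 := v |: B :\ u in psdB1 cardB1 *.
have CB1 y : y \in C -> y \notin B1.
  move=> yC; rewrite !inE negb_or negb_and negbK.
  have := subsetP (component_sub _ _) y yC; rewrite inE => ->; rewrite orbT andbT.
  by apply: contraNneq vC => <-.
have xC : x \in C by rewrite component_id ?inE.
have CC : C \subset component_in (~: B1) x.
  apply: component_min => [|a b aC _ bC ab]; first by rewrite component_id ?in_setC ?CB1.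
  by apply: (component_adj aC); rewrite // in_setC CB1.
have eqC : component_in (~: B1) x = C.
  by apply/esym/eqP; rewrite eqEcard CC max_x ?cardB1 ?CB1.
split=> //; split; rewrite ?eqC ?cardB1 ?CB1 //.
Qed.

Lemma maximal_white_no_force u v a :
  psd_force B u v -> v \notin C -> a \in C -> adj u a -> False.
Proof.
move=> Buv vC aC ua; have [_ eqC] := maximal_white_exchange Buv vC.
have /psd_forceP[uB vB _ _] := Buv.
have : u \in C.
  rewrite -eqC; apply: (@component_adj _ _ a); rewrite ?eqC // 1?adj_sym //.
  by rewrite !inE eqxx orbF; apply: contraNN vB => /eqP <-.
by move/(subsetP (component_sub _ _)); rewrite inE uB.
Qed.

End Maximal.

Lemma maximal_white_neighbor B x a b y : maximal_white B x ->
  b \in B -> a \in component_in (~: B) x -> adj b a -> adj b y ->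
  y \notin B -> y \in component_in (~: B) x.
Proof.
have [n] := ubnP #|component_in (~: B) y|.
elim: n B y => // n IHn B y /ltnSE leyn maxBx bB aC ba by_ yB.
apply/negPn/negP => yC.
have disj z : z \in component_in (~: B) y -> z \notin component_in (~: B) x.
  move=> zy; apply: contra yC => zx; apply: component_trans zx _.
  by apply: component_sym zy; rewrite inE.
have [psdB _ _ _] := maxBx.
have yy : y \in component_in (~: B) y by rewrite component_id ?inE.
have /forallPn[z] : ~~ [forall z, (z \in component_in (~: B) y) && adj b z ==> (z == y)].
  apply/negP => /forallP uniq_y; apply: (@maximal_white_no_force _ _ maxBx b y a) => //.
  by apply/psd_forceP; split=> // z zy bz; apply/eqP; apply: implyP (uniq_y z) _; rewrite zy.
rewrite negb_imply => /andP[/andP[zy bz] nzy].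
have [u [v [Buv vy]]] := psd_force_into psdB yB.
have vx := disj v vy.
have nbu : b != u.
  apply/eqP => bu; apply: (maximal_white_no_force maxBx Buv vx aC).
  by rewrite -bu.
have [y' [y'y by' ny'v]] : exists y', [/\ y' \in component_in (~: B) y, adj b y' & y' != v].
  have [yv|] := eqVneq y v; last by exists y.
  by exists z; rewrite -yv.
have [maxB1 eqC] := maximal_white_exchange maxBx Buv vx.
have /psd_forceP[uB vB uv uniq_v] := Buv.
set B1 := v |: B :\ u in maxB1 eqC *.
have y'B : y' \notin B by move/(subsetP (component_sub _ _)): y'y; rewrite inE.
have y'B1 : y' \notin B1 by rewrite !inE (negbTE ny'v) (negbTE y'B) andbF.
have /negP[] := disj y' y'y; rewrite -eqC; apply: IHn => //; rewrite ?eqC //; last first.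
  by rewrite !inE bB nbu orbT.
apply: leq_trans leyn; rewrite (cardsD1 v (component_in _ y)) vy ltnS subset_leq_card //.
apply: component_min => [|p q]; first by rewrite !in_setD1 ny'v.
rewrite !in_setD1 => /andP[npv py] _ /(subsetP (component_sub _ _)) qB1 pq.
have /andP[-> qB] /= : (q != v) && ((q == u) || (q \notin B)).
  by move: qB1; rewrite !inE negb_or negb_and negbK.
have [qu|nqu] := eqVneq q u.
  case/negP: npv; apply/eqP/uniq_v; last by rewrite -qu adj_sym.
  apply: component_trans py; apply: component_sym vy.
  by rewrite inE.
have qB' : q \in ~: B by rewrite inE; case/orP: qB => // /eqP/(elimN eqP nqu).
exact: component_adj py qB' pq.
Qed.

Lemma maximal_white_connected B x : connected_graph G -> maximal_white B x ->
  component_in (~: B) x = ~: B.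
Proof.
move=> connG maxBx; have [psdB cardB xB max_x] := maxBx.
set C := component_in (~: B) x.
pose N := [set z in B | [exists a in C, adj z a]].
have NP z a : z \in B -> a \in C -> adj z a -> z \in N.
  by move=> zB aC za; rewrite inE zB; apply/exists_inP; exists a.
have NC z y : z \in N -> adj z y -> y \notin B -> y \in C.
  rewrite inE => /andP[zB /exists_inP[a aC za]].
  exact: maximal_white_neighbor maxBx zB aC za.
have CB z : z \in C -> z \notin B.
  by move/(subsetP (component_sub _ _)); rewrite inE.
have closN z w : z \in N -> w \in B -> adj z w -> w \in N.
  move=> zN wB zw; apply/negPn/negP => wN.
  have zB : z \in B by move: zN; rewrite inE => /andP[].
  have nzw : z != w by apply: contraNneq wN => <-.
  have : Zplus G <= #|B :\ w|.
    apply: forcing_number_min; apply: (@forcing_set_force _ _ z w); last by rewrite setD1K.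
    apply/psd_forceP; split; rewrite ?inE ?eqxx ?nzw //.
    have wC : component_in (~: (B :\ w)) w \subset ~: C.
      apply: component_min => [|p q]; first by rewrite inE; apply: contraL wB => /CB.
      rewrite !in_setC => pC /(subsetP (component_sub _ _)) pBw _ pq.
      apply: contra pC => qC.
      have pB : (p == w) || (p \notin B) by move: pBw; rewrite !inE negb_and negbK.
      have [pw|npw] := eqVneq p w.
        by case/negP: wN; apply: (NP _ q) => //; rewrite -pw.
      apply: (component_adj qC); rewrite 1?adj_sym // inE.
      by rewrite (negbTE npw) in pB.
    move=> t tw zt; have := subsetP wC t tw; rewrite in_setC => tC.
    apply/eqP; apply: contraNT tC => ntw; apply: NC zN zt _.
    by move/(subsetP (component_sub _ _)): tw; rewrite !inE (negbTE ntw).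
  by rewrite -cardB (cardsD1 w B) wB ltnn.
apply/eqP; rewrite eqEsubset component_sub; apply/subsetP => y; rewrite inE => yB.
suff : y \in C :|: N by rewrite in_setU => /orP[] //; rewrite inE (negbTE yB).
have /connectP[p pth ->] := connG x y.
have clos z w : z \in C :|: N -> adj z w -> w \in C :|: N.
  rewrite !in_setU => zCN zw; have [wB|wB] := boolP (w \in B).
    case/orP: zCN => [zC|/closN->//]; last by rewrite orbT.
    by rewrite (NP w z) ?orbT // adj_sym.
  case/orP: zCN => [zC|zN]; last by rewrite (NC z).
  by rewrite (component_adj zC) ?inE.
have closp z q : path (@adj G) z q -> z \in C :|: N -> last z q \in C :|: N.
  by elim: q z => [|w q IHq] z //= /andP[zw wq] /clos/(_ zw); apply: IHq.
by rewrite closp // in_setU component_id ?inE.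
Qed.

Lemma psd_set_white_connected : connected_graph G ->
  exists B, [/\ psd_set B, #|B| = Zplus G &
    {in ~: B, forall x, component_in (~: B) x = ~: B}].
Proof.
move=> connG; have [B0 psdB0 cardB0] := forcing_number_ex (@psd_rule G).
have [B0T|] := eqVneq B0 setT.
  by exists B0; split=> // x; rewrite B0T !inE.
rewrite -subTset => /subsetPn[x0 _ x0B0].
pose P (p : {set G} * G) := [&& psd_set p.1, #|p.1| == Zplus G & p.2 \notin p.1].
pose f (p : {set G} * G) := #|component_in (~: p.1) p.2|.
have P0 : P (B0, x0) by apply/and3P; split=> //; apply/eqP.
case: (@arg_maxnP _ (B0, x0) P f P0) => -[B x] /and3P[/= psdB /eqP cardB xB] max_x.
have defW : component_in (~: B) x = ~: B.
  apply: maximal_white_connected => //; split=> // B' x' psdB' cardB' x'B'.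
  by apply: (max_x (B', x')); apply/and3P; split=> //; apply/eqP.
exists B; split=> // y yB; apply/eqP; rewrite eqEsubset component_sub /=.
apply/subsetP => z; rewrite -{1}defW => zx.
have yx : y \in component_in (~: B) x by rewrite defW.
by apply: component_trans zx; apply: component_sym yx; rewrite inE.
Qed.

Lemma claw_free_white_connected B u v : claw_free G -> psd_force B u v ->
  {in ~: B, forall x, component_in (~: B) x = ~: B} ->
  {in ~: (v |: B), forall x, component_in (~: (v |: B)) x = ~: (v |: B)}.
Proof.
move=> clawG /psd_forceP[uB vB uv uniq_v] connW.
have vW : v \in ~: B by rewrite inE.
rewrite connW // in uniq_v.
set W := ~: (v |: B).
have WP z : (z \in W) = (z != v) && (z \in ~: B) by rewrite !inE negb_or.
have attach x : x \in W -> exists2 a, a \in component_in W x & adj v a.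
  move=> xW; have xB : x \in ~: B by move: xW; rewrite WP => /andP[].
  apply/exists_inP; apply: contraLR vW => /exists_inPn nv.
  rewrite -(connW x xB); apply: (contra (subsetP _ v)) (_ : v \notin component_in W x).
    apply: component_min => [|p q px _]; first exact: component_id.
    rewrite connW // => qB pq; apply: (component_adj px) => //.
    rewrite WP qB andbT; apply: contraTneq pq => ->.
    by rewrite adj_sym nv.
  apply/negP => /(subsetP (component_sub _ _)).
  by rewrite WP eqxx.
move=> x xW; apply/eqP; rewrite eqEsubset component_sub; apply/subsetP => y yW.
have [a ax va] := attach x xW; have [b by_ vb] := attach y yW.
have ab_y : b \in component_in W x -> y \in component_in W x.
  by move=> bx; apply: component_trans bx _; apply: component_sym by_.
have un w : w \in W -> ~~ adj u w /\ u != w.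
  rewrite WP => /andP[/eqP nwv wB]; split; first by apply/negP => /(uniq_v w wB).
  by apply: contraTneq wB => <-; rewrite inE uB.
have aW := subsetP (component_sub _ _) a ax.
have bW := subsetP (component_sub _ _) b by_.
have [[/negbTE ua nua] [/negbTE ub nub]] := (un a aW, un b bW).
have [eab|nab] := eqVneq a b; first by apply: ab_y; rewrite -eab.
have := claw_freeP clawG (etrans (adj_sym v u) uv) va vb nua nub nab.
by rewrite ua ub /= => ab; apply/ab_y/(component_adj ax bW ab).
Qed.

Lemma psd_set_standard B : claw_free G -> psd_set B ->
  {in ~: B, forall x, component_in (~: B) x = ~: B} ->
  forcing_set (@standard_rule G) B.
Proof.
move=> clawG; have [n] := ubnP #|~: B|; elim: n B => // n IHn B /ltnSE leBn psdB connW.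
have [->|BT] := eqVneq B setT; first exact: connect0.
have [u [v Buv]] := proj1 (forcing_setP psd_rule_mono B) psdB B (subxx _) BT.
have /and3P[uB vB uv] := Buv.
apply: (@forcing_set_force _ B u v).
  by rewrite /valid_force uB vB; move: uv; rewrite /psd_rule connW // inE.
apply: IHn; last exact: claw_free_white_connected Buv connW.
  apply: leq_trans leBn; rewrite setCU setIC -setDE.
  by rewrite [leqRHS](cardsD1 v) inE vB.
exact: forcing_set_sup psd_rule_mono (subsetUr _ _) psdB.
Qed.

End ForcingSets.

Theorem theorem5 (G : sgraph) (G_connected : connected_graph G)
  (G_claw_free : claw_free G) : Zplus G = Z G.
Proof.
apply/eqP; rewrite eqn_leq Zplus_le_Z /=.
have [B [psdB <- connW]] := psd_set_white_connected G_connected.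
exact/forcing_number_min/psd_set_standard.
Qed.
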